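(* Let $B:\mathfrak b\to\mathfrak a$ be a left deformation map of a quasi-twilled Lie conformal algebra $(\mathcal E,\mathfrak a,\mathfrak b)$. For a $\mathbb C[\partial]$-module homomorphism $B':\mathfrak b\to\mathfrak a$, the sum $B+B'$ is a left deformation map if and only if $B'$ is a Maurer-Cartan element of the twisted $L_\infty$-algebra $\bigl(\bigoplus_{n\ge0}\mathscr C^{n+1}(\mathfrak b,\mathfrak a),l_1^B,l_2^B,l_3^B\bigr)$, that is, $$l_1^B(B')+\tfrac12l_2^B(B',B')+\tfrac16l_3^B(B',B',B')=0,$$ where $$l_1^B(f)=l_1(f)+l_2(B,f)+\tfrac12l_3(B,B,f),\quad l_2^B(f_1,f_2)=l_2(f_1,f_2)+l_3(B,f_1,f_2),\quad l_3^B(f_1,f_2,f_3)=l_3(f_1,f_2,f_3),$$ $l_k^B=0$ for $k\ge4$, and $l_1(f)=[\widehat\nu_2,\widehat f\,]_{NR}$, $l_2(f_1,f_2)=[[\widehat\nu_1,\widehat f_1]_{NR},\widehat f_2]_{NR}$, $l_3(f_1,f_2,f_3)=[[[\widehat\psi,\widehat f_1]_{NR},\widehat f_2]_{NR},\widehat f_3]_{NR}$.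
   Context: All vector spaces and linear maps are over $\mathbb C$, and all $\mathbb C[\partial]$-modules are finitely generated. A Lie conformal algebra is a $\mathbb C[\partial]$-module $\mathcal E$ with a $\mathbb C$-linear map $\mathcal E\otimes\mathcal E\to\mathcal E[\lambda]$, $x\otimes y\mapsto\{x_\lambda y\}$, such that $\{\partial x_\lambda y\}=-\lambda\{x_\lambda y\}$, $\{x_\lambda\partial y\}=(\partial+\lambda)\{x_\lambda y\}$, $\{x_\lambda y\}=-\{y_{-\lambda-\partial}x\}$ and $\{x_\lambda\{y_\mu z\}\}=\{\{x_\lambda y\}_{\lambda+\mu}z\}+\{y_\mu\{x_\lambda z\}\}$ ($\partial$ in a subscript acts from the left on the coefficients). A quasi-twilled Lie conformal algebra $(\mathcal E,\mathfrak a,\mathfrak b)$ is a Lie conformal algebra with a $\mathbb C[\partial]$-module decomposition $\mathcal E=\mathfrak a\oplus\mathfrak b$ such that $\mathfrak b$ is a subalgebra. For $a,b\in\mathfrak a$, $u,v\in\mathfrak b$ set $\{a_\lambda b\}_{\mathfrak a}=\mathrm{pr}_{\mathfrak a}\{a_\lambda b\}$, $\psi_{1,\lambda}(a,b)=\mathrm{pr}_{\mathfrak b}\{a_\lambda b\}$, $\varrho_{\mathfrak b}(u)_\lambda a=\mathrm{pr}_{\mathfrak a}\{u_\lambda a\}$, $\varrho_{\mathfrak a}(a)_\lambda v=\mathrm{pr}_{\mathfrak b}\{a_\lambda v\}$, $\{u_\lambda v\}_{\mathfrak b}=\{u_\lambda v\}$. A left deformation map is a $\mathbb C[\partial]$-module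 homomorphism $B:\mathfrak b\to\mathfrak a$ whose graph $\{(B(u),u)\mid u\in\mathfrak b\}$ is a Lie conformal subalgebra of $\mathcal E$. Cochains: for $\mathbb C[\partial]$-modules $M,N$ and $k\ge1$, $\mathscr C^k(M,N)$ is the space of $\mathbb C$-linear maps $\varphi:M^{\otimes k}\to\mathbb C[\lambda_1,\dots,\lambda_{k-1}]\otimes N$ such that, with $\lambda_k^\ddagger:=-\sum_{j=1}^{k-1}\lambda_j-\partial$ ($\partial$ acting on $N$ from the left), (i) $\varphi(\dots,\partial a_i,\dots)=-\lambda_i\varphi(\dots,a_i,\dots)$ for $1\le i\le k-1$ and $\varphi(\dots,\partial a_k)=-\lambda_k^\ddagger\varphi(\dots,a_k)$; (ii) for every permutation $\sigma$, $\varphi_{\lambda_1,\dots,\lambda_{k-1}}(a_1,\dots,a_k)=(-1)^\sigma\varphi_{\lambda_{\sigma(1)},\dots,\lambda_{\sigma(k-1)}}(a_{\sigma(1)},\dots,a_{\sigma(k)})|_{\lambda_k\mapsto\lambda_k^\ddagger}$. In particular $\mathscr C^1(M,N)=\mathrm{Hom}_{\mathbb C[\partial]}(M,N)$. Nijenhuis-Richardson bracket: for $f\in\mathscr C^m(\mathcal E,\mathcal E)$, $g\in\mathscr C^n(\mathcal E,\mathcal E)$, $[f,g]_{NR}:=f\star g-(-1)^{(m-1)(n-1)}g\star f$, with $$(f\star g)_{\lambda_1,\dots,\lambda_{m+n-2}}(x_1,\dots,x_{m+n-1})=\sum_{\sigma}(-1)^\sigma f_{\lambda_{\sigma(1)}+\cdots+\lambda_{\sigma(n)},\lambda_{\sigma(n+1)},\dots,\lambda_{\sigma(m+n-2)}}\bigl(g_{\lambda_{\sigma(1)},\dots,\lambda_{\sigma(n-1)}}(x_{\sigma(1)},\dots,x_{\sigma(n)}),x_{\sigma(n+1)},\dots,x_{\sigma(m+n-1)}\bigr)\big|_{\lambda_{m+n-1}\mapsto\lambda_{m+n-1}^\ddagger}$$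 over $(n,m-1)$-unshuffles (i.e. $\sigma(1)<\dots<\sigma(n)$ and $\sigma(n+1)<\dots<\sigma(m+n-1)$). The $\lambda$-bracket $\Omega$ of $\mathcal E$ decomposes as $\Omega=\widehat\psi+\widehat\nu_1+\widehat\nu_2$ with $\widehat\psi_\lambda((a,u),(b,v))=(0,\psi_{1,\lambda}(a,b))$, $\widehat\nu_{1,\lambda}((a,u),(b,v))=(\{a_\lambda b\}_{\mathfrak a},\varrho_{\mathfrak a}(a)_\lambda v-\varrho_{\mathfrak a}(b)_{-\lambda-\partial}u)$, $\widehat\nu_{2,\lambda}((a,u),(b,v))=(\varrho_{\mathfrak b}(u)_\lambda b-\varrho_{\mathfrak b}(v)_{-\lambda-\partial}a,\{u_\lambda v\}_{\mathfrak b})$. For $f\in\mathscr C^k(\mathfrak b,\mathfrak a)$, $\widehat f((a_1,u_1),\dots,(a_k,u_k))=(f(u_1,\dots,u_k),0)$; $f$ is identified with $\widehat f$. The space $\bigoplus_{n\ge0}\mathscr C^{n+1}(\mathfrak b,\mathfrak a)$, graded with $\mathscr C^{n+1}$ in degree $n$, with $l_1(f)=[\widehat\nu_2,\widehat f\,]_{NR}$, $l_2(f_1,f_2)=[[\widehat\nu_1,\widehat f_1]_{NR},\widehat f_2]_{NR}$, $l_3(f_1,f_2,f_3)=[[[\widehat\psi,\widehat f_1]_{NR},\widehat f_2]_{NR},\widehat f_3]_{NR}$ and $l_k=0$ for $k\ge4$, is an $L_\infty$-algebra (graded symmetric, degree $1$ operations) of which $B$ is a Maurer-Cartan element: $l_1(B)+\frac12l_2(B,B)+\frac16l_3(B,B,B)=0$;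 the twisted operations $l_k^B$ again form an $L_\infty$-algebra. *)

(* Defs.v *)
From HB Require Import structures.
From mathcomp Require Import all_boot all_order all_algebra.
From mathcomp Require Import fingroup perm.
From mathcomp Require Import finmap monalg.

Set Implicit Arguments.
Unset Strict Implicit.
Unset Printing Implicit Defensive.

Import GRing.Theory.
Local Open Scope ring_scope.

(* K[∂] is {poly K}, so a K[∂]-module is an lmodType {poly K}: ∂ acts as 'X   *)
(* and K acts through the constant polynomials.                               *)

Definition finitely_generated (A : nzRingType) (M : lmodType A) : Prop :=
  exists s : seq M, forall x : M,
    exists c : 'I_(size s) -> A, x = \sum_(i < size s) c i *: s`_i.

(* K[∂][λ_0, ..., λ_(r-1)] *)
Notation dlpoly K r := {malg {poly K}['X_{1..r}]}.

Section LambdaPolynomials.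
Variable K : fieldType.
Implicit Type r : nat.

Definition lam r (i : 'I_r) : dlpoly K r := << ucm i >>.
Definition del r : dlpoly K r := malgC ('X : {poly K}).
Definition scal r (c : K) : dlpoly K r := malgC c%:P.

(* K[λ_0, ..., λ_(r-1)] ⊗ N, as finitely supported families of elements of N  *)
(* indexed by monomials.  It is a module over K[∂][λ_0, ..., λ_(r-1)], with ∂ *)
(* acting on the coefficients.                                                *)
Definition lpoly r (N : lmodType {poly K}) : Type := {malg N['X_{1..r}]}.

HB.instance Definition _ r N := GRing.Zmodule.copy (lpoly r N) {malg N['X_{1..r}]}.

Section Scale.
Variables (r : nat) (N : lmodType {poly K}).
Implicit Types (g h : dlpoly K r) (P Q : lpoly r N).

Definition lscale g P : lpoly r N :=
  \sum_(m1 <- msupp g) \sum_(m2 <- msupp P) << g@_m1 *: P@_m2 *g mmul m1 m2 >>.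

Lemma lscalew (d1 d2 : {fset 'X_{1..r}}) g P :
    (msupp g `<=` d1)%fset -> (msupp P `<=` d2)%fset ->
  lscale g P =
    \sum_(m1 <- d1) \sum_(m2 <- d2) << g@_m1 *: P@_m2 *g mmul m1 m2 >>.
Proof.
move=> le1 le2; rewrite /lscale (big_fset_incl _ le1) /=.
  apply: eq_bigr => m _; apply/big_fset_incl => // k _ /mcoeff_outdom ->.
  by rewrite scaler0 monalgU0.
move=> m _ /mcoeff_outdom gm; rewrite big1 // => k _.
by rewrite gm scale0r monalgU0.
Qed.

Lemma lscaleDl P : {morph lscale^~ P : g h / g + h}.
Proof.
move=> g h; set d := (msupp g `|` msupp h)%fset.
have dP := fsubset_refl (msupp P).
rewrite (lscalew (msuppD_le g h) dP) (lscalew (fsubsetUl _ (msupp h)) dP).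
rewrite (lscalew (fsubsetUr (msupp g) _) dP) -big_split /=.
apply: eq_bigr => m _; rewrite -big_split /=; apply: eq_bigr => k _.
by rewrite mcoeffD scalerDl monalgUD.
Qed.

Lemma lscaleDr : right_distributive lscale +%R.
Proof.
move=> g P Q; have dg := fsubset_refl (msupp g).
rewrite (lscalew dg (msuppD_le P Q)) (lscalew dg (fsubsetUl _ (msupp Q))).
rewrite (lscalew dg (fsubsetUr (msupp P) _)) -big_split /=.
apply: eq_bigr => m _; rewrite -big_split /=; apply: eq_bigr => k _.
by rewrite [(P + Q)@_k]mcoeffD scalerDr monalgUD.
Qed.

Lemma lscaleUU c m (x : N) k :
  lscale << c *g m >> (<< x *g k >> : lpoly r N) = << c *: x *g mmul m k >>.
Proof. by rewrite (lscalew msuppU_le msuppU_le) !big_seq_fset1 !mcoeffUU. Qed.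

Lemma lscale0r g : lscale g 0 = 0.
Proof. by apply: (@addrI _ (lscale g 0)); rewrite -lscaleDr !addr0. Qed.

Lemma lscale0l P : lscale 0 P = 0.
Proof. by apply: (@addrI _ (lscale 0 P)); rewrite -lscaleDl !addr0. Qed.

Lemma lscale_sumr I (s : seq I) (F : I -> lpoly r N) g :
  lscale g (\sum_(i <- s) F i) = \sum_(i <- s) lscale g (F i).
Proof. exact: (big_morph (lscale g) (lscaleDr g) (lscale0r g)). Qed.

Lemma lscale_suml I (s : seq I) (F : I -> dlpoly K r) P :
  lscale (\sum_(i <- s) F i) P = \sum_(i <- s) lscale (F i) P.
Proof. exact: (big_morph (lscale^~ P) (lscaleDl P) (lscale0l P)). Qed.

Lemma lscale1 : left_id 1 lscale.
Proof.
move=> P; rewrite [RHS]monalgE [in LHS](monalgE P) lscale_sumr.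
by apply: eq_bigr => k _; rewrite lscaleUU scale1r mul1m.
Qed.

Lemma lscaleA g h P : lscale g (lscale h P) = lscale (g * h) P.
Proof.
rewrite (monalgE P) (lscale_sumr _ _ h) (lscale_sumr _ _ g).
rewrite (lscale_sumr _ _ (g * h)); apply: eq_bigr => k _.
rewrite (monalgE h) mulr_sumr !lscale_suml (lscale_sumr _ _ g).
apply: eq_bigr => m _; rewrite (monalgE g) mulr_suml !lscale_suml.
apply: eq_bigr => n _.
transitivity (lscale << g@_n *g n >>
    (<< h@_m *: P@_k *g mmul m k >> : lpoly r N)).
  by congr lscale; apply: lscaleUU.
by rewrite malgM_def fgmulUU [LHS]lscaleUU [RHS]lscaleUU scalerA mulmA.
Qed.

HB.instance Definition _ :=
  GRing.Zmodule_isLmodule.Build (dlpoly K r) (lpoly r N)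
    lscaleA lscale1 lscaleDr lscaleDl.

End Scale.

Definition lconst r (N : lmodType {poly K}) (x : N) : lpoly r N :=
  malgC x.

(* For P = \sum_m λ^m x_m, lbind s h P = \sum_m s^m h(x_m): the variables are *)
(* replaced by s and h is extended K[λ]-linearly.                             *)
Definition lbind p r (N N' : lmodType {poly K}) (s : 'I_p -> dlpoly K r)
    (h : N -> lpoly r N') (P : lpoly p N) : lpoly r N' :=
  \sum_(m <- msupp P) (\prod_(i < p) s i ^+ m i) *: h P@_m.

(* P(s_0, ..., s_(p-1)), any ∂ in the s_i acting from the left.               *)
Definition lsubst p r (N : lmodType {poly K}) (s : 'I_p -> dlpoly K r)
    (P : lpoly p N) : lpoly r N :=
  lbind s (@lconst r N) P.

Definition lmap r (N N' : lmodType {poly K}) (h : N -> N')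
    (P : lpoly r N) : lpoly r N' :=
  lbind (@lam r) (fun x => lconst r (h x)) P.

(* λ_0, ..., λ_(r-1), followed by λ_r^‡ = - λ_0 - ... - λ_(r-1) - ∂.          *)
Definition lamd r (i : 'I_r.+1) : dlpoly K r :=
  if unlift ord_max i is Some j then lam j else - \sum_(j < r) lam j - del r.

End LambdaPolynomials.

Section LieConformal.
Variable K : fieldType.

Definition skew_sub : 'I_1 -> dlpoly K 1 := fun=> - lam K ord0 - del K 1.

Record lie_conformal (E : lmodType {poly K}) := LieConformal {
  lbr :> E -> E -> lpoly 1 E;
  lbr_linl : forall c x y z,
    lbr (c%:P *: x + y) z = scal 1 c *: lbr x z + lbr y z;
  lbr_linr : forall c x y z,
    lbr x (c%:P *: y + z) = scal 1 c *: lbr x y + lbr x z;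
  lbr_dell : forall x y, lbr ('X *: x) y = - lam K ord0 *: lbr x y;
  lbr_delr : forall x y, lbr x ('X *: y) = (del K 1 + lam K ord0) *: lbr x y;
  lbr_skew : forall x y, lbr x y = - lsubst skew_sub (lbr y x);
  lbr_jacobi : forall x y z,
    let l : dlpoly K 2 := lam K 0 in let mu : dlpoly K 2 := lam K 1 in
    lbind (fun=> mu) (fun w => lsubst (fun=> l) (lbr x w)) (lbr y z) =
    lbind (fun=> l) (fun w => lsubst (fun=> l + mu) (lbr w z)) (lbr x y) +
    lbind (fun=> l) (fun w => lsubst (fun=> mu) (lbr y w)) (lbr x z) }.

Definition subalgebra (E : lmodType {poly K}) (br : lie_conformal E)
    (S : E -> Prop) : Prop :=
  [/\ S 0,
      forall (p : {poly K}) x y, S x -> S y -> S (p *: x + y) &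
      forall x y, S x -> S y -> forall m, S (br x y)@_m ].

(* The decomposition is the external direct sum a × b.                        *)
Record quasi_twilled (a b : lmodType {poly K}) := QuasiTwilled {
  qt_br :> lie_conformal (a * b)%type;
  qt_sub : subalgebra qt_br (fun z => z.1 = 0) }.

Definition left_deformation (a b : lmodType {poly K})
    (E : quasi_twilled a b) (B : {linear b -> a}) : Prop :=
  subalgebra E (fun z => z.1 = B z.2).

End LieConformal.

Section Cochains.
Variable K : fieldType.

Definition upd (T : Type) n (x : 'I_n -> T) (i : 'I_n) (y : T) : 'I_n -> T :=
  fun j => if j == i then y else x j.

(* The index p is the degree: such a map has p.+1 arguments.                  *)
Definition precochain (p : nat) (M N : lmodType {poly K}) : Type :=
  ('I_p.+1 -> M) -> lpoly p N.

Record cochain (p : nat) (M N : lmodType {poly K}) := Cochain {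
  cochain_fun :> ('I_p.+1 -> M) -> lpoly p N;
  cochain_lin : forall x i c y z,
    cochain_fun (upd x i (c%:P *: y + z)) =
    scal p c *: cochain_fun (upd x i y) + cochain_fun (upd x i z);
  cochain_del : forall x i,
    cochain_fun (upd x i ('X *: x i)) = - lamd K i *: cochain_fun x;
  cochain_skew : forall x (s : 'S_p.+1),
    cochain_fun x =
    (-1) ^+ s *: lsubst (fun i => lamd K (s (lift ord_max i)))
                        (cochain_fun (fun i => x (s i))) }.

Section HomCochain.
Variables (M N : lmodType {poly K}) (B : {linear M -> N}).

Definition hom_fun : precochain 0 M N := fun x => lconst 0 (B (x ord0)).

Lemma lconstD r : {morph @lconst K r N : x y / x + y}.
Proof. exact: monalgUD. Qed.

Lemma lconstZ r (p : {poly K}) (y : N) :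
  lconst r (p *: y) = (malgC p : dlpoly K r) *: lconst r y.
Proof. by rewrite [RHS]lscaleUU mul1m. Qed.

Lemma hom_lin x i c y z :
  hom_fun (upd x i (c%:P *: y + z)) =
  scal 0 c *: hom_fun (upd x i y) + hom_fun (upd x i z).
Proof. by rewrite /hom_fun /upd (ord1 i) eqxx linearP lconstD lconstZ. Qed.

Lemma hom_del x i :
  hom_fun (upd x i ('X *: x i)) = - lamd K i *: hom_fun x.
Proof.
have -> : lamd K i = - del K 0.
  by rewrite /lamd; case: unliftP => [[]//|_]; rewrite big_ord0 oppr0 sub0r.
by rewrite opprK /hom_fun /upd (ord1 i) eqxx linearZ lconstZ.
Qed.

Lemma hom_skew x (s : 'S_1) :
  hom_fun x =
  (-1) ^+ s *: lsubst (fun i => lamd K (s (lift ord_max i)))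
                      (hom_fun (fun i => x (s i))).
Proof.
have -> : s = 1%g by apply/permP => i; rewrite !ord1.
rewrite odd_perm1 expr0 scale1r /hom_fun perm1 /lsubst /lbind.
rewrite msuppU; case: eqP => [->|_]; first by rewrite big_seq_fset0 [LHS]monalgU0.
by rewrite big_seq_fset1 big_ord0 scale1r mcoeffUU.
Qed.

Definition hom_cochain : cochain 0 M N := Cochain hom_lin hom_del hom_skew.

End HomCochain.

End Cochains.

Section NijenhuisRichardson.
Variables (K : fieldType) (E : lmodType {poly K}).

(* σ is an (n, N - n)-unshuffle of N objects, 0-based.                        *)
Definition unshuffle N (n : nat) (s : 'S_N) : bool :=
  [forall i : 'I_N, forall j : 'I_N,
     (i < j)%N && ((j < n)%N || (n <= i)%N) ==> (s i < s j)%N].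

(* f ⋆ g for f of degree p and g of degree q, where r is meant to be p + q    *)
(* (a parameter, so that f ⋆ g and g ⋆ f can have the same type).  The        *)
(* variable λ_r is replaced by λ_r^‡ from the start, which makes sense as all *)
(* coefficients act on the result.                                            *)
Definition nr_star p q r (f : precochain p E E) (g : precochain q E E) :
    precochain r E E := fun x =>
  \sum_(s : 'S_r.+1 | unshuffle q.+1 s)
    let l k := lamd K (s (inord k)) in
    (-1) ^+ s *:
    lbind (fun i : 'I_q => l i)
      (fun w =>
         lsubst (fun j : 'I_p => if j == 0 :> nat then \sum_(i < q.+1) l i
                                 else l (q + j)%N)
           (f (fun j : 'I_p.+1 => if j == 0 :> nat then w
                                  else x (s (inord (q + j))))))
      (g (fun i : 'I_q.+1 => x (s (inord i)))).

Definition nr_bracket p q (f : precochain p E E) (g : precochain q E E) :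
    precochain (p + q) E E := fun x =>
  nr_star f g x - (-1) ^+ (p * q) *: nr_star g f x.

End NijenhuisRichardson.

Section Controlling.
Variables (K : fieldType) (a b : lmodType {poly K}) (E : quasi_twilled a b).

Definition ina (x : a) : (a * b)%type := (x, 0).
Definition inb (u : b) : (a * b)%type := (0, u).
Definition lpair r (P : lpoly r a) (Q : lpoly r b) : lpoly r (a * b)%type :=
  lmap ina P + lmap inb Q.

Definition br_a (x y : a) : lpoly 1 a := lmap fst (E (ina x) (ina y)).
Definition psi1 (x y : a) : lpoly 1 b := lmap snd (E (ina x) (ina y)).
Definition rho_b (u : b) (x : a) : lpoly 1 a := lmap fst (E (inb u) (ina x)).
Definition rho_a (x : a) (v : b) : lpoly 1 b := lmap snd (E (ina x) (inb v)).
(* As b is a subalgebra, the second projection loses nothing here.            *)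
Definition br_b (u v : b) : lpoly 1 b := lmap snd (E (inb u) (inb v)).

Definition on2 (h : (a * b)%type -> (a * b)%type -> lpoly 1 (a * b)%type) :
  precochain 1 (a * b)%type (a * b)%type := fun x => h (x 0) (x 1).

Definition psi_hat := on2 (fun z w => lpair 0 (psi1 z.1 w.1)).
Definition nu1_hat := on2 (fun z w =>
  lpair (br_a z.1 w.1)
        (rho_a z.1 w.2 - lsubst (@skew_sub K) (rho_a w.1 z.2))).
Definition nu2_hat := on2 (fun z w =>
  lpair (rho_b z.2 w.1 - lsubst (@skew_sub K) (rho_b w.2 z.1))
        (br_b z.2 w.2)).

Definition hat p (f : cochain p b a) :
    precochain p (a * b)%type (a * b)%type :=
  fun x => lpair (f (fun i => (x i).2)) 0.

(* A cochain f is identified with hat f, so the operations take values in     *)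
(* maps on a × b.                                                             *)
Notation value n := (precochain n (a * b)%type (a * b)%type).

Definition l1 n (f : cochain n b a) : value n.+1 :=
  nr_bracket nu2_hat (hat f).
Definition l2 n1 n2 (f1 : cochain n1 b a) (f2 : cochain n2 b a) :
    value (n1 + n2).+1 :=
  nr_bracket (nr_bracket nu1_hat (hat f1)) (hat f2).
Definition l3 n1 n2 n3 (f1 : cochain n1 b a) (f2 : cochain n2 b a)
    (f3 : cochain n3 b a) : value (n1 + n2 + n3).+1 :=
  nr_bracket (nr_bracket (nr_bracket psi_hat (hat f1)) (hat f2)) (hat f3).

Section Twisted.
Variable B : cochain 0 b a.

Definition l1_tw n (f : cochain n b a) : value n.+1 := fun x =>
  l1 f x + l2 B f x + scal n.+1 2^-1 *: (l3 B B f : value n.+1) x.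
Definition l2_tw n1 n2 (f1 : cochain n1 b a) (f2 : cochain n2 b a) :
    value (n1 + n2).+1 := fun x =>
  l2 f1 f2 x + l3 B f1 f2 x.
Definition l3_tw n1 n2 n3 (f1 : cochain n1 b a) (f2 : cochain n2 b a)
    (f3 : cochain n3 b a) : value (n1 + n2 + n3).+1 := l3 f1 f2 f3.

(* The operations of arity at least 4 are zero, so the sum stops here.         *)
Definition twisted_maurer_cartan (f : cochain 0 b a) : Prop :=
  forall x, l1_tw f x + scal 1 2^-1 *: (l2_tw f f : value 1) x
                      + scal 1 6^-1 *: (l3_tw f f f : value 1) x = 0.

End Twisted.

End Controlling.

(* Main.v *)
Require Import Defs.
From HB Require Import structures.
From mathcomp Require Import all_boot all_order all_algebra.
From mathcomp Require Import fingroup perm finmap monalg.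
From mathcomp Require Import boolp functions.
From mathcomp Require Import reals complex.
Import GRing.Theory.
Local Open Scope ring_scope.

(** For a K[∂]-linear map C : b -> a let Ĉ be the square-zero endomorphism
    (x, u) |-> (C u, 0) of E = a × b.  The Nijenhuis-Richardson bracket of a
    skew-symmetric λ-bracket w with Ĉ is
      D_C w (z, t) = w (Ĉ z, t) + w (z, Ĉ t) - Ĉ w (z, t)
    ([nr_bracket_hom]).  As Ĉ² = 0, the exponential of D_C is a finite sum, and
    exp(D_C) Ω is the λ-bracket of E transported by the automorphism 1 + Ĉ:
      (1 - Ĉ) Ω ((1 + Ĉ) z, (1 + Ĉ) t).
    This automorphism maps b onto the graph of C, so C is a left deformation map
    exactly when the component b × b -> a of exp(D_C) Ω vanishes.  Counting how
    often Ĉ has to be inserted in each of the three pieces of Ω to reach that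
    component, one finds that it is the curvature
      F(C) = D_C ν₂ + 1/2 D_C² ν₁ + 1/6 D_C³ ψ
    ([curvatureE], [left_deformation_curvature]).

    The operators D_B and D_B' commute because Ĉ Ĉ' = 0 for all C and C', and
    D_(B + B') = D_B + D_B'.  The binomial formula therefore gives F(B + B') as
    F(B) plus the terms that contain D_B' at least once, and these terms are the
    Maurer-Cartan expression of B' in the algebra twisted by B ([curvatureD],
    [twisted_maurer_cartanP]).  Since B is a left deformation map, F(B) = 0, so
    F(B + B') = 0 if and only if B' is a Maurer-Cartan element.

    The computations with D_C are purely additive, so they are made for
    biadditive maps between abstract abelian groups.  They apply to λ-brackets
    because the coefficientwise extension of a K[∂]-linear map commutes with
    substitutions for λ ([lmap_lsubst]). *)

Set Implicit Arguments.
Unset Strict Implicit.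
Unset Printing Implicit Defensive.

(** * Substitution and coefficientwise maps on λ-polynomials *)

Lemma morphD_zmod_morphism (U V : zmodType) (F : U -> V) :
  {morph F : x y / x + y} -> zmod_morphism F.
Proof. by move=> FD x y; apply/eqP; rewrite eq_sym subr_eq -FD subrK. Qed.

Section LambdaCalculus.
Variable K : fieldType.
Implicit Types (N : lmodType {poly K}).

Lemma lbindw p r N N' (s : 'I_p -> dlpoly K r) (h : N -> lpoly r N')
    (P : lpoly p N) (d : {fset 'X_{1..p}}) :
    h 0 = 0 -> (msupp P `<=` d)%fset ->
  lbind s h P = \sum_(m <- d) (\prod_(i < p) s i ^+ m i) *: h P@_m.
Proof.
move=> h0 led; rewrite /lbind (big_fset_incl _ led) //= => m _.
by move/mcoeff_outdom => ->; rewrite h0 scaler0.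
Qed.

Lemma lbindD p r N N' (s : 'I_p -> dlpoly K r) (h : N -> lpoly r N') :
  h 0 = 0 -> {morph h : x y / x + y} -> {morph lbind s h : P Q / P + Q}.
Proof.
move=> h0 hD P Q.
rewrite (lbindw s h0 (msuppD_le P Q)) (lbindw s h0 (fsubsetUl _ (msupp Q))).
rewrite (lbindw s h0 (fsubsetUr (msupp P) _)) -big_split /=.
by apply: eq_bigr => m _; rewrite [(P + Q)@_m]mcoeffD hD scalerDr.
Qed.

Lemma lbind_lconst p r N N' (s : 'I_p -> dlpoly K r) (h : N -> lpoly r N') x :
  h 0 = 0 -> lbind s h (lconst p x) = h x.
Proof.
move=> h0; rewrite (lbindw s h0 msuppU_le) big_seq_fset1 mcoeffUU.
by rewrite big1 ?scale1r // => i _; rewrite cm1 expr0.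
Qed.

Lemma lconst0 r N : lconst r (0 : N) = 0.
Proof. exact: monalgU0. Qed.

Lemma lsubstD p r N (s : 'I_p -> dlpoly K r) :
  {morph @lsubst K p r N s : P Q / P + Q}.
Proof. by apply: lbindD; [apply: lconst0 | apply: lconstD]. Qed.

Lemma lsubst0 p r N (s : 'I_p -> dlpoly K r) : lsubst s (0 : lpoly p N) = 0.
Proof. by apply: (@addrI _ (lsubst s 0)); rewrite -lsubstD !addr0. Qed.

HB.instance Definition _ p r N (s : 'I_p -> dlpoly K r) :=
  GRing.isZmodMorphism.Build (lpoly p N) (lpoly r N) (lsubst s)
    (morphD_zmod_morphism (lsubstD s)).

Lemma eq_lsubst p r N (s s' : 'I_p -> dlpoly K r) (P : lpoly p N) :
  s =1 s' -> lsubst s P = lsubst s' P.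
Proof. by move=> /funext ->. Qed.

Lemma monalgUM r (c d : {poly K}) (m k : 'X_{1..r}) :
  << c *g m >> * << d *g k >> = << c * d *g mmul m k >> :> dlpoly K r.
Proof. by rewrite malgM_def fgmulUU. Qed.

Lemma lam_expE r (i : 'I_r) n :
  lam K i ^+ n = << 1 *g iter n (mmul (ucm i)) mone >>.
Proof.
elim: n => [|n IHn]; first by rewrite expr0.
rewrite exprS IHn {1}/lam monalgUM mulr1; reflexivity.
Qed.

Lemma prod_lam r (m : 'X_{1..r}) :
  \prod_(i < r) lam K i ^+ m i = << 1 *g m >>.
Proof.
have prodU (s : seq 'I_r) (F : 'I_r -> 'X_{1..r}) :
    \prod_(i <- s) (<< 1 *g F i >> : dlpoly K r)
      = << 1 *g \big[mmul/mone]_(i <- s) F i >>.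
  elim: s => [|i s IHs]; first by rewrite !big_nil.
  rewrite !big_cons IHs monalgUM mulr1; reflexivity.
under eq_bigr => i _ do rewrite lam_expE.
rewrite prodU.
suff -> : \big[mmul/mone]_(i < r) iter (m i) (mmul (ucm i)) mone = m.
  reflexivity.
apply/eqP/cmP => j.
have bigE (s : seq 'I_r) (F : 'I_r -> 'X_{1..r}) :
    (\big[mmul/mone]_(i <- s) F i) j = (\sum_(i <- s) F i j)%N.
  elim: s => [|i s IHs]; first by rewrite !big_nil cm1.
  by rewrite !big_cons cmM IHs.
have iterE n (i : 'I_r) : iter n (mmul (ucm i)) mone j = (n * (i == j))%N.
  elim: n => [|n IHn]; first by rewrite cm1.
  by rewrite mulSn -IHn iterS cmM cmU.
rewrite bigE (bigD1 j) //= iterE eqxx muln1 big1 ?addn0 // => i neij.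
by rewrite iterE (negPf neij) muln0.
Qed.

Lemma lsubst_lam r N (P : lpoly r N) : lsubst (@lam K r) P = P.
Proof.
rewrite [RHS]monalgE; apply: eq_bigr => m _.
by rewrite prod_lam [LHS]lscaleUU scale1r mulm1.
Qed.

(** The induction principle for the identities below: the terms x λ^m generate
    the λ-polynomials as an abelian group. *)
Lemma eq_morph_lpoly r N (V : zmodType) (F G : lpoly r N -> V) :
    {morph F : P Q / P + Q} -> {morph G : P Q / P + Q} ->
    (forall x m, F << x *g m >> = G << x *g m >>) -> F =1 G.
Proof.
move=> FD GD FG P.
have F0 : F 0 = 0 by apply: (addrI (F 0)); rewrite -FD !addr0.
have G0 : G 0 = 0 by apply: (addrI (G 0)); rewrite -GD !addr0.
rewrite (monalgE P); apply: etrans (esym (big_morph G GD G0 _ _ _)).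
by apply: etrans (big_morph F FD F0 _ _ _) _; apply: eq_bigr => m _.
Qed.

Lemma lbindU p r N N' (s : 'I_p -> dlpoly K r) (h : N -> lpoly r N') x m :
  h 0 = 0 -> lbind s h << x *g m >> = (\prod_(i < p) s i ^+ m i) *: h x.
Proof.
by move=> h0; rewrite (lbindw s h0 msuppU_le) big_seq_fset1 mcoeffUU.
Qed.

Lemma lmapU r N N' (h : {additive N -> N'}) x (m : 'X_{1..r}) :
  lmap h (<< x *g m >> : lpoly r N) = << h x *g m >>.
Proof.
rewrite [LHS]lbindU ?raddf0 ?lconst0 // prod_lam.
by rewrite [LHS]lscaleUU scale1r mulm1.
Qed.

Lemma lmapD r N N' (h : {additive N -> N'}) :
  {morph @lmap K r N N' h : P Q / P + Q}.
Proof.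
apply: lbindD => [|x y]; first by rewrite raddf0 lconst0.
by rewrite raddfD lconstD.
Qed.

HB.instance Definition _ r N N' (h : {additive N -> N'}) :=
  GRing.isZmodMorphism.Build (lpoly r N) (lpoly r N') (lmap h)
    (morphD_zmod_morphism (lmapD h)).

Lemma lmap_comp r N1 N2 N3 (h : {additive N2 -> N3}) (k : {additive N1 -> N2})
    (l : {additive N1 -> N3}) (P : lpoly r N1) :
  (forall x, h (k x) = l x) -> lmap h (lmap k P) = lmap l P.
Proof.
move=> hk.
suff /(_ P): (fun Q => lmap h (lmap k Q)) =1 @lmap K r N1 N3 l by [].
apply: eq_morph_lpoly => [Q Q'|Q Q'|x m].
- by rewrite !lmapD.
- by rewrite lmapD.
by rewrite !lmapU hk.
Qed.

Lemma lmap_comp0 r N1 N2 N3 (h : {additive N2 -> N3})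
    (k : {additive N1 -> N2}) (P : lpoly r N1) :
  (forall x, h (k x) = 0) -> lmap h (lmap k P) = 0.
Proof.
move=> hk.
suff /(_ P): (fun Q : lpoly r N1 => lmap h (lmap k Q)) =1 (fun=> 0) by [].
apply: eq_morph_lpoly => [Q Q'|Q Q'|x m].
- by rewrite !lmapD.
- by rewrite addr0.
by rewrite !lmapU hk monalgU0.
Qed.

Lemma lmap_addmap r N N' (h k l : {additive N -> N'}) (P : lpoly r N) :
  (forall x, l x = h x + k x) -> lmap l P = lmap h P + lmap k P.
Proof.
move=> lE.
suff /(_ P): @lmap K r N N' l =1 (fun Q => lmap h Q + lmap k Q) by [].
apply: eq_morph_lpoly => [Q Q'|Q Q'|x m].
- exact: lmapD.
- exact: etrans (congr2 +%R (lmapD h Q Q') (lmapD k Q Q')) (addrACA _ _ _ _).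
by rewrite !lmapU lE; exact: monalgUD.
Qed.

Lemma lmapZ r N N' (h : {linear N -> N'}) g (P : lpoly r N) :
  lmap h (g *: P) = g *: lmap h P.
Proof.
suff /(_ P): (fun Q : lpoly r N => lmap h (g *: Q))
    =1 (fun Q => g *: lmap h Q) by [].
apply: eq_morph_lpoly => [Q Q'|Q Q'|x m].
- by rewrite scalerDr lmapD.
- by rewrite lmapD scalerDr.
rewrite lmapU [X in lmap _ X](_ : _ = lscale g << x *g m >>) //.
rewrite [RHS](_ : _ = lscale g << h x *g m >>) //.
rewrite [in LHS](monalgE g) [in RHS](monalgE g).
rewrite !lscale_suml raddf_sum; apply: eq_bigr => k _.
rewrite !lscaleUU; apply: etrans (lmapU h _ _) _.
exact: (congr1 (fun y => << y *g mmul k m >>) (linearZ_LR h _ x)).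
Qed.

(** The substituted polynomials may involve ∂, which acts on the coefficients;
    this is why h has to be K[∂]-linear and not only K-linear. *)
Lemma lmap_lsubst p r N N' (h : {linear N -> N'}) (s : 'I_p -> dlpoly K r)
    (P : lpoly p N) :
  lmap h (lsubst s P) = lsubst s (lmap h P).
Proof.
suff /(_ P): (fun Q : lpoly p N => lmap h (lsubst s Q))
    =1 (fun Q => lsubst s (lmap h Q)) by [].
apply: eq_morph_lpoly => [Q Q'|Q Q'|x m].
- by rewrite lsubstD lmapD.
- by rewrite lmapD lsubstD.
rewrite lmapU /lsubst !lbindU ?lconst0 // lmapZ.
by rewrite [lmap _ _]lmapU.
Qed.

Lemma mcoeff_lmap r N N' (h : {additive N -> N'}) (P : lpoly r N) m :
  (lmap h P)@_m = h P@_m.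
Proof.
suff /(_ P): (fun Q : lpoly r N => (lmap h Q)@_m) =1 (fun Q => h Q@_m) by [].
apply: eq_morph_lpoly => [Q Q'|Q Q'|x k].
- rewrite lmapD; exact: mcoeffD.
- exact: etrans (congr1 h (mcoeffD _ _ _)) (raddfD h _ _).
by rewrite lmapU !mcoeffU raddfMn.
Qed.

End LambdaCalculus.

(** * The Nijenhuis-Richardson bracket with a cochain of degree 0 *)

Lemma perm2P (s : 'S_2) : s = 1%g \/ s = tperm 0 1.
Proof.
have ord2 (i : 'I_2) : i = 0 \/ i = 1.
  by case: i => [[|[|]]] // lti; [left|right]; apply: val_inj.
have neq : s 0 <> s 1 by move/perm_inj.
case: (ord2 (s 0)) (ord2 (s 1)) => s0 [] s1; try by case: neq; rewrite s0 s1.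
  by left; apply/permP => i; case: (ord2 i) => ->; rewrite perm1.
by right; apply/permP => i; case: (ord2 i) => ->; rewrite ?tpermL ?tpermR.
Qed.

Lemma big_perm2 (V : nmodType) (P : pred 'S_2) (F : 'S_2 -> V) :
  \sum_(s | P s) F s =
    (if P 1%g then F 1%g else 0) + (if P (tperm 0 1) then F (tperm 0 1) else 0).
Proof.
have neq : tperm (0 : 'I_2) 1 != 1%g.
  by apply/eqP => /permP /(_ 0); rewrite tpermL perm1.
rewrite big_mkcond (bigD1 1%g) //= (bigD1 (tperm 0 1)) //=.
by rewrite big1 ?addr0 // => s /andP[]; case: (perm2P s) => ->; rewrite eqxx.
Qed.

Lemma inord20 : inord 0 = 0 :> 'I_2.
Proof. by apply: val_inj; rewrite /= inordK. Qed.

Lemma inord21 : inord 1 = 1 :> 'I_2.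
Proof. by apply: val_inj; rewrite /= inordK. Qed.

Lemma unshuffle12 (s : 'S_2) : unshuffle 1 s.
Proof.
by apply/forallP => -[[|[]] //] ?; apply/forallP => -[[|[]] //] ?.
Qed.

Lemma unshuffle22 (s : 'S_2) : unshuffle 2 s = (s 0%R < s 1%R)%N.
Proof.
apply/forallP/idP => [/(_ 0)/forallP/(_ 1)//|s01] i; apply/forallP => j.
apply/implyP => /andP[ltij _]; suff [-> ->] : i = 0 /\ j = 1 by [].
by split; apply: val_inj; case: i j ltij => [[|[]] // ?] [[|[]] // ?].
Qed.

Lemma lamd0 (K : fieldType) : lamd K (0 : 'I_2) = lam K 0.
Proof.
have e0 : (0 : 'I_2) = lift ord_max (0 : 'I_1) by apply: val_inj.
by rewrite /lamd e0 liftK.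
Qed.

Lemma lamd1 (K : fieldType) : lamd K (1 : 'I_2) = - lam K 0 - del K 1.
Proof.
have e1 : (1 : 'I_2) = ord_max by apply: val_inj.
by rewrite /lamd e1 unlift_none big_ord1.
Qed.

Section Star.
Variables (K : fieldType) (E : lmodType {poly K}).
Variables (w : E -> E -> lpoly 1 E) (h : {linear E -> E}).
Variables (f : precochain 1 E E) (g : precochain 0 E E).
Hypothesis fE : forall x, f x = w (x 0) (x 1).
Hypothesis gE : forall x, g x = lconst 0 (h (x 0)).

(** Only the identity is a (2,0)-unshuffle, and it contributes the composite of
    w with h. *)
Lemma nr_star_hom_left (x : 'I_2 -> E) :
  nr_star (r := 1) g f x = lmap h (w (x 0) (x 1)).
Proof.
rewrite /nr_star big_perm2 2!unshuffle22 perm1 perm1 tpermL tpermR /=.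
rewrite odd_perm1 expr0 scale1r addr0 fE /= inord20 inord21 2!perm1 /lmap.
set s := (fun i : 'I_1 => _); set k := (fun y : E => _).
have -> : s = @lam K 1.
  by apply/funext => i; rewrite /s (ord1 i) inord20 perm1 lamd0.
suff -> : k = (fun y => lconst 1 (h y)) by [].
by apply/funext => y; rewrite /k gE /lsubst lbind_lconst ?lconst0.
Qed.

Hypothesis w0 : forall z, w 0 z = 0.
Hypothesis wS : forall z t, w z t = - lsubst (@skew_sub K) (w t z).

(** Both permutations are (1,1)-unshuffles.  The transposition puts x 1 in front,
    and skew-symmetry brings its term back to w (x 0) (h (x 1)). *)
Lemma nr_star_hom_right (x : 'I_2 -> E) :
  nr_star (r := 1) f g x = w (h (x 0)) (x 1) + w (x 0) (h (x 1)).
Proof.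
rewrite /nr_star big_perm2 2!unshuffle12.
rewrite odd_perm1 odd_tperm /= expr0 scale1r expr1 scaleN1r.
rewrite !gE !lbind_lconst; [|by rewrite /= fE w0 lsubst0..].
rewrite /= !fE /= inord20 inord21 2!perm1 tpermL tpermR; congr (_ + _).
  apply: etrans (lsubst_lam _); apply: eq_lsubst => i.
  by rewrite (ord1 i) /= big_ord1 inord20 perm1 lamd0.
rewrite (wS (x 0)); apply: (congr1 (fun P => - P)); apply: eq_lsubst => i.
by rewrite (ord1 i) /= big_ord1 inord20 tpermL lamd1.
Qed.

Lemma nr_bracket_hom (x : 'I_2 -> E) :
  nr_bracket f g x =
    w (h (x 0)) (x 1) + w (x 0) (h (x 1)) - lmap h (w (x 0) (x 1)).
Proof.
rewrite /nr_bracket muln0 expr0 scale1r.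
exact: (congr2 (fun P Q => P - Q) (nr_star_hom_right x) (nr_star_hom_left x)).
Qed.

End Star.

(** * Derivations of biadditive maps *)

Section Scalars.
Variables (R : pzRingType) (c2 c6 : R) (U : lmodType R).
Hypotheses (c2E : c2 *+ 2 = 1) (c6E : c6 *+ 6 = 1).

Lemma half_double (v : U) : c2 *: (v *+ 2) = v.
Proof. by rewrite -scalerMnr scalerMnl c2E scale1r. Qed.

Lemma sixth_sextuple (v : U) : c6 *: (v *+ 6) = v.
Proof. by rewrite -scalerMnr scalerMnl c6E scale1r. Qed.

Lemma sixth_triple (v : U) : c6 *: (v *+ 3) = c2 *: v.
Proof. by rewrite -[LHS]half_double scalerMnr -mulrnA sixth_sextuple. Qed.

(** The coefficients of the binomial formulas for the square and the cube,
    divided by 2! and 3!.  The repeated summands are those produced by expanding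
    (D + D')² and (D + D')³ for commuting D and D'. *)
Lemma half_sixth_binomial (a a' b0 b1 b2 p0 p1 p2 p3 : U) :
  a + a' + c2 *: (b0 + b1 + (b1 + b2)) +
    c6 *: (p0 + p1 + (p1 + p2) + (p1 + p2 + (p2 + p3))) =
  a + c2 *: b0 + c6 *: p0 +
    (a' + b1 + c2 *: p1 + c2 *: (b2 + p2) + c6 *: p3).
Proof.
have half (v : U) : c2 *: v + c2 *: v = v.
  by rewrite -scalerDr -mulr2n half_double.
have third (v : U) : c6 *: v + c6 *: v + c6 *: v = c2 *: v.
  by rewrite -2!scalerDr -(sixth_triple v) !mulrS mulr0n addr0 addrA.
rewrite !scalerDr !addrA.
by rewrite [LHS](ACl (1*3*7*2*(4*5)*(8*9*11)*6*(10*12*13)*14)) /= half !third.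
Qed.

End Scalars.

Section Derivations.
Variables (M V : zmodType).
Implicit Types (h : M -> M) (H : V -> V) (w : M -> M -> V).

Definition biadditive w : Prop :=
  (forall x y t, w (x + y) t = w x t + w y t) /\
  (forall z x y, w z (x + y) = w z x + w z y).

Lemma biadditive0l w z : biadditive w -> w 0 z = 0.
Proof. by case=> wl _; apply: (addrI (w 0 z)); rewrite -wl !addr0. Qed.

Lemma biadditive0r w z : biadditive w -> w z 0 = 0.
Proof. by case=> _ wr; apply: (addrI (w z 0)); rewrite -wr !addr0. Qed.

(** The bracket of w with an endomorphism.  The maps h and H stand for the same
    endomorphism of E, acting on E and on the λ-polynomials over E. *)
Definition nr_deriv h H w : M -> M -> V :=
  fun z t => w (h z) t + w z (h t) - H (w z t).

Lemma nr_derivD h (H : {additive V -> V}) w w' :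
  nr_deriv h H (w + w') = nr_deriv h H w + nr_deriv h H w'.
Proof.
apply/funext => z; apply/funext => t; rewrite /nr_deriv !addrfctE raddfD opprD.
by rewrite !addrA [LHS](ACl (1*3*5*2*4*6)).
Qed.

Lemma biadditive_nr_deriv (h : {additive M -> M}) (H : {additive V -> V}) w :
  biadditive w -> biadditive (nr_deriv h H w).
Proof.
case=> wl wr; split=> [x y t|z x y]; rewrite /nr_deriv.
  rewrite (raddfD h) !wl raddfD opprD.
  by rewrite !addrA [LHS](ACl (1*3*5*2*4*6)).
rewrite (raddfD h) !wr raddfD opprD.
by rewrite !addrA [LHS](ACl (1*3*5*2*4*6)).
Qed.

Lemma nr_deriv_addmap (h k l : M -> M) (H K L : V -> V) w :
    (forall z, l z = h z + k z) -> (forall v, L v = H v + K v) ->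
    biadditive w ->
  nr_deriv l L w = nr_deriv h H w + nr_deriv k K w.
Proof.
move=> lE LE [wl wr]; apply/funext => z; apply/funext => t.
rewrite /nr_deriv !addrfctE lE lE LE wl wr opprD.
by rewrite !addrA [LHS](ACl (1*3*5*2*4*6)).
Qed.

Lemma nr_derivC (h k : M -> M) (H K : {additive V -> V}) w :
    (forall z, h (k z) = k (h z)) -> (forall v, H (K v) = K (H v)) ->
  nr_deriv h H (nr_deriv k K w) = nr_deriv k K (nr_deriv h H w).
Proof.
move=> hk HK; apply/funext => z; apply/funext => t.
rewrite /nr_deriv (raddfB H) (raddfD H) (raddfB K) (raddfD K) !hk HK.
(* Both sides expand to the same three by three array, which is read by rows on
   the left and by columns on the right. *)
by rewrite !opprD !opprK !addrA [LHS](ACl (1*4*7*2*5*8*3*6*9)).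
Qed.

(** The operator is a sum of three commuting operators, each inserting h in one
    slot, whose squares vanish; in its square and its cube only the products of
    distinct operators remain, with multiplicities 2! and 3!. *)
Lemma nr_deriv2 (h : {additive M -> M}) (H : {additive V -> V}) w z t :
    (forall z, h (h z) = 0) -> (forall v, H (H v) = 0) -> biadditive w ->
  nr_deriv h H (nr_deriv h H w) z t =
    (w (h z) (h t) - H (w (h z) t) - H (w z (h t))) *+ 2.
Proof.
move=> hh HH wB; rewrite /nr_deriv !hh (biadditive0l _ wB) (biadditive0r _ wB).
rewrite add0r addr0 (raddfB H) (raddfD H) HH subr0 opprD mulr2n.
by rewrite !addrA [LHS](ACl (1*2*4*3*5*6)).
Qed.

Lemma nr_deriv3 (h : {additive M -> M}) (H : {additive V -> V}) w z t :
    (forall z, h (h z) = 0) -> (forall v, H (H v) = 0) -> biadditive w ->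
  nr_deriv h H (nr_deriv h H (nr_deriv h H w)) z t =
    (- H (w (h z) (h t))) *+ 6.
Proof.
move=> hh HH wB; rewrite nr_deriv2 //; last exact: biadditive_nr_deriv.
rewrite /nr_deriv !hh !(biadditive0l _ wB) !(biadditive0r _ wB) !add0r addr0.
by rewrite !(raddfB H) !HH !subr0 -mulr2n -mulrSr -mulrnA.
Qed.

Variable tau : {additive V -> V}.

(** Here [tau] stands for the substitution of - λ - ∂ for λ. *)
Definition skew_under w : Prop := forall z t, w z t = - tau (w t z).

Lemma skew_nr_deriv h (H : {additive V -> V}) w :
  (forall v, tau (H v) = H (tau v)) -> skew_under w ->
  skew_under (nr_deriv h H w).
Proof.
move=> tauH wS z t; rewrite /nr_deriv (wS (h z)) (wS z (h t)) (wS z t).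
rewrite (raddfN H) -tauH -opprD -opprD (raddfB tau) (raddfD tau).
by rewrite [X in - (X - _)]addrC.
Qed.

End Derivations.

(** * The curvature and its binomial expansion *)

Section Curvature.
Variables (R : pzRingType) (M : zmodType) (V : lmodType R).
Implicit Types (h : M -> M) (H : V -> V).
Variables (c2 c6 : R) (psi nu1 nu2 : M -> M -> V).
Hypotheses (c2E : c2 *+ 2 = 1) (c6E : c6 *+ 6 = 1).
Hypotheses (psiB : biadditive psi).
Hypotheses (nu1B : biadditive nu1) (nu2B : biadditive nu2).

(** The left-hand side of the untwisted Maurer-Cartan equation, with c2 and c6
    in the place of 1/2 and 1/6. *)
Definition curvature h H : M -> M -> V :=
  nr_deriv h H nu2 + c2 *: nr_deriv h H (nr_deriv h H nu1)
    + c6 *: nr_deriv h H (nr_deriv h H (nr_deriv h H psi)).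

(** The binomial formula for the commuting operators D and D', applied to each
    summand of the curvature.  The terms with at least one D' are listed in the
    order of the twisted operations of arity one, two and three. *)
Lemma curvatureD (h k l : {additive M -> M}) (H K L : {additive V -> V}) :
    (forall z, l z = h z + k z) -> (forall v, L v = H v + K v) ->
    (forall z, h (k z) = k (h z)) -> (forall v, H (K v) = K (H v)) ->
  let D := nr_deriv h H in let D' := nr_deriv k K in
  curvature l L = curvature h H
    + (D' nu2 + D' (D nu1) + c2 *: D' (D (D psi))
       + c2 *: (D' (D' nu1) + D' (D' (D psi))) + c6 *: D' (D' (D' psi))).
Proof.
move=> lE LE hk HK D D'.
have DS w : biadditive w -> nr_deriv l L w = D w + D' w.
  exact: nr_deriv_addmap.
have DD w w' : D (w + w') = D w + D w' by exact: nr_derivD.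
have D'D w w' : D' (w + w') = D' w + D' w' by exact: nr_derivD.
have DC w : D (D' w) = D' (D w) by exact: nr_derivC.
have SB w : biadditive w -> biadditive (D w + D' w).
  by move=> wB; rewrite -DS //; exact: biadditive_nr_deriv.
rewrite /curvature -/D (DS nu2) // (DS nu1) // (DS psi) //.
rewrite (DS (_ + _)); last exact: SB.
rewrite (DS (D psi + D' psi)); last exact: SB.
rewrite DS; last exact/SB/SB.
clearbody D D'; rewrite !(DD, D'D, DC).
move: (D nu2) (D' nu2) (D (D nu1)) (D' (D nu1)) (D' (D' nu1)) => a a' b0 b1 b2.
move: (D (D (D psi))) (D' (D (D psi))) (D' (D' (D psi))) (D' (D' (D' psi))).
move=> p0 p1 p2 p3.
exact: half_sixth_binomial.
Qed.

End Curvature.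

Section Transport.
Variables (R : pzRingType) (M : zmodType) (V : lmodType R).
Variables (c2 c6 : R) (e : M -> M -> V).
(* A and B are the two projections of E, p and q the same projections on values;
   h and H are the map (x, u) |-> (C u, 0) on E and on values. *)
Variables (A B h : {additive M -> M}) (p q H : {additive V -> V}).

Definition psi_part z t := q (e (A z) (A t)).

(** In [nu1_part] and [nu2_part] the substitution of - λ - ∂ that occurs in
    [nu1_hat] and [nu2_hat] has been removed by the skew-symmetry of e. *)
Definition nu1_part z t := p (e (A z) (A t)) + q (e (A z) (B t) + e (B z) (A t)).
Definition nu2_part z t := p (e (B z) (A t) + e (A z) (B t)) + q (e (B z) (B t)).

Hypothesis eB : biadditive e.

Lemma biadditive_psi_part : biadditive psi_part.
Proof.
have [eDl eDr] := eB; split=> x y z; rewrite /psi_part.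
  by rewrite (raddfD A) eDl raddfD.
by rewrite (raddfD A) eDr raddfD.
Qed.

Lemma biadditive_nu1_part : biadditive nu1_part.
Proof.
have [eDl eDr] := eB; split=> x y z; rewrite /nu1_part !(raddfD A, raddfD B).
  by rewrite !eDl !(raddfD p, raddfD q) !addrA [LHS](ACl (1*3*5*2*4*6)).
by rewrite !eDr !(raddfD p, raddfD q) !addrA [LHS](ACl (1*3*5*2*4*6)).
Qed.

Lemma biadditive_nu2_part : biadditive nu2_part.
Proof.
have [eDl eDr] := eB; split=> x y z; rewrite /nu2_part !(raddfD A, raddfD B).
  by rewrite !eDl !(raddfD p, raddfD q) !addrA [LHS](ACl (1*3*5*2*4*6)).
by rewrite !eDr !(raddfD p, raddfD q) !addrA [LHS](ACl (1*3*5*2*4*6)).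
Qed.

Section SkewParts.
Variable tau : {additive V -> V}.
Hypotheses (tau_p : forall v, tau (p v) = p (tau v)).
Hypotheses (tau_q : forall v, tau (q v) = q (tau v)).
Hypothesis eS : skew_under tau e.

Lemma skew_psi_part : skew_under tau psi_part.
Proof. by move=> z t; rewrite /psi_part tau_q eS raddfN. Qed.

Lemma skew_nu1_part : skew_under tau nu1_part.
Proof.
move=> z t; rewrite /nu1_part (raddfD tau) tau_p tau_q (raddfD tau).
rewrite (eS (A z)) (eS (A z)) (eS (B z)) -opprD !raddfN -opprD.
by rewrite [tau _ + _]addrC.
Qed.

Lemma skew_nu2_part : skew_under tau nu2_part.
Proof.
move=> z t; rewrite /nu2_part (raddfD tau) tau_p tau_q (raddfD tau).
rewrite (eS (A z)) (eS (B z) (A t)) (eS (B z)) -opprD !raddfN -opprD.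
by rewrite [tau _ + _]addrC.
Qed.

End SkewParts.

Hypotheses (c2E : c2 *+ 2 = 1) (c6E : c6 *+ 6 = 1).
Hypotheses (Ah : forall z, A (h z) = h z) (Bh : forall z, B (h z) = 0).
Hypotheses (hh : forall z, h (h z) = 0) (HH : forall v, H (H v) = 0).
Hypotheses (Hp : forall v, H (p v) = 0) (Hq : forall v, H (q v) = H v).
Hypothesis p_sub : forall z t, p (e (B z) (B t)) = 0.

(** The value of e on the graph splits into four terms, one for each choice of
    the component h or B of its two arguments.  The projection p kills the term
    without h, because b is a subalgebra; the other terms of p and the four terms
    of H are distributed over the three summands of the curvature according to
    the number of insertions of h. *)
Lemma curvatureE z t :
  curvature c2 c6 psi_part nu1_part nu2_part h H z t =
    p (e (h z + B z) (h t + B t)) - H (e (h z + B z) (h t + B t)).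
Proof.
have e0l s := biadditive0l s eB; have e0r s := biadditive0r s eB.
have [eDl eDr] := eB.
rewrite /curvature !addrfctE !scalrfctE.
rewrite nr_deriv3 //; last exact: biadditive_psi_part.
rewrite nr_deriv2 //; last exact: biadditive_nu1_part.
rewrite half_double // sixth_sextuple //.
rewrite /nr_deriv /psi_part /nu1_part /nu2_part.
rewrite !(Ah, Bh, e0l, e0r, raddf0, addr0, add0r).
rewrite !(eDl, eDr) !(raddfD p, raddfD q, raddfD H) !(Hp, Hq) p_sub.
rewrite !(addr0, add0r, raddfD H) !opprD !addrA.
by rewrite [LHS](ACl (4*1*2*7*5*6*3)).
Qed.

End Transport.

(** * The pieces of the λ-bracket of a quasi-twilled algebra *)

Section DirectSum.
Variables (K : fieldType) (a b : lmodType {poly K}).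

Lemma ina_linear : linear (@ina K a b).
Proof.
by move=> c x y; apply: injective_projections; rewrite //= scaler0 addr0.
Qed.

Lemma inb_linear : linear (@inb K a b).
Proof.
by move=> c x y; apply: injective_projections; rewrite //= scaler0 addr0.
Qed.

HB.instance Definition _ :=
  GRing.isLinear.Build {poly K} a (a * b)%type *:%R (@ina K a b) ina_linear.
HB.instance Definition _ :=
  GRing.isLinear.Build {poly K} b (a * b)%type *:%R (@inb K a b) inb_linear.

Definition proj_a (z : (a * b)%type) : (a * b)%type := ina b z.1.
Definition proj_b (z : (a * b)%type) : (a * b)%type := inb a z.2.
Definition hat_map (C : b -> a) (z : (a * b)%type) : (a * b)%type :=
  ina b (C z.2).

Lemma proj_a_linear : linear proj_a.
Proof. by move=> c x y; rewrite /proj_a linearP. Qed.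

Lemma proj_b_linear : linear proj_b.
Proof. by move=> c x y; rewrite /proj_b linearP. Qed.

Lemma hat_map_linear (C : {linear b -> a}) : linear (hat_map C).
Proof. by move=> c x y; rewrite /hat_map /= linearP linearP. Qed.

HB.instance Definition _ :=
  GRing.isLinear.Build {poly K} (a * b)%type (a * b)%type *:%R proj_a
    proj_a_linear.
HB.instance Definition _ :=
  GRing.isLinear.Build {poly K} (a * b)%type (a * b)%type *:%R proj_b
    proj_b_linear.
HB.instance Definition _ (C : {linear b -> a}) :=
  GRing.isLinear.Build {poly K} (a * b)%type (a * b)%type *:%R (hat_map C)
    (hat_map_linear C).

End DirectSum.

Section LieConformal.
Variables (K : fieldType) (E : lmodType {poly K}) (br : lie_conformal E).

Lemma biadditive_lbr : biadditive br.
Proof.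
have s1 : scal 1 (1 : K) = 1 by rewrite /scal polyC1 mpolyC1E.
split=> x y z.
  by have := lbr_linl br 1 x y z; rewrite polyC1 s1 !scale1r.
by have := lbr_linr br 1 x y z; rewrite polyC1 s1 !scale1r.
Qed.

Lemma skew_lbr : skew_under (@lsubst K 1 1 E (@skew_sub K)) br.
Proof. exact: lbr_skew. Qed.

End LieConformal.

Section QuasiTwilled.
Variables (K : fieldType) (a b : lmodType {poly K}) (E : quasi_twilled a b).
Notation ab := (a * b)%type.
Notation e := (lbr E).
Notation pa := (@proj_a K a b).
Notation pb := (@proj_b K a b).
Notation p := (lmap pa).
Notation q := (lmap pb).
Notation psi := (psi_part e pa q).
Notation nu1 := (nu1_part e pa pb p q).
Notation nu2 := (nu2_part e pa pb p q).

Lemma psi_hatE x : psi_hat E x = psi (x 0) (x 1).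
Proof.
by rewrite /psi_hat /on2 /lpair raddf0 add0r; exact: lmap_comp.
Qed.

Lemma lsubst_lmap_lbr (N : lmodType {poly K}) (g : {linear ab -> N}) x y :
  - lsubst (@skew_sub K) (lmap g (e x y)) = lmap g (e y x).
Proof.
apply: etrans (congr1 -%R (esym (lmap_lsubst g _ _))) _.
by rewrite (lbr_skew E y x) raddfN.
Qed.

Lemma nu1_hatE x : nu1_hat E x = nu1 (x 0) (x 1).
Proof.
rewrite /nu1_hat /on2 /lpair /nu1_part; apply: congr2; first exact: lmap_comp.
apply: etrans (congr1 _ (congr1 (fun P => _ + P) (lsubst_lmap_lbr snd _ _))) _.
apply: etrans (raddfD _ _ _) _; apply: etrans _ (esym (raddfD _ _ _)).
by apply: congr2; apply: lmap_comp.
Qed.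

Lemma nu2_hatE x : nu2_hat E x = nu2 (x 0) (x 1).
Proof.
rewrite /nu2_hat /on2 /lpair /nu2_part; apply: congr2; last exact: lmap_comp.
apply: etrans (congr1 _ (congr1 (fun P => _ + P) (lsubst_lmap_lbr fst _ _))) _.
apply: etrans (raddfD _ _ _) _; apply: etrans _ (esym (raddfD _ _ _)).
by apply: congr2; apply: lmap_comp.
Qed.

(** * The twisted Maurer-Cartan expression *)

Notation tau := (@lsubst K 1 1 ab (@skew_sub K)).

(** Iterated Nijenhuis-Richardson brackets are precochains; biadditivity and
    skew-symmetry are carried along because each further bracket needs them. *)
Definition represents (f : precochain 1 ab ab)
    (w : ab -> ab -> lpoly 1 ab) : Prop :=
  [/\ forall x, f x = w (x 0) (x 1), biadditive w & skew_under tau w].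

Notation deriv C := (nr_deriv (@hat_map K a b C) (lmap (@hat_map K a b C))).

Lemma hat_hom_cochainE (C : {linear b -> a}) (x : 'I_1 -> ab) :
  hat (hom_cochain C) x = lconst 0 (hat_map C (x 0)).
Proof.
by rewrite /hat /lpair raddf0 addr0; exact: lmapU.
Qed.

Lemma tau_lmap (g : {linear ab -> ab}) v : tau (lmap g v) = lmap g (tau v).
Proof. exact/esym/lmap_lsubst. Qed.

Lemma represents_deriv (C : {linear b -> a}) f w :
  represents f w ->
  represents (nr_bracket f (hat (hom_cochain C))) (deriv C w).
Proof.
case=> fE wB wS; split.
- move=> x; apply: (nr_bracket_hom fE (hat_hom_cochainE C)) => // z.
  exact: biadditive0l.
- exact: biadditive_nr_deriv.
have := @skew_nr_deriv _ _ tau (hat_map C) (lmap (hat_map C)) w (tau_lmap _) wS.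
exact.
Qed.

Lemma represents_psi : represents (psi_hat E) psi.
Proof.
split; [exact: psi_hatE | exact/biadditive_psi_part/biadditive_lbr |].
by apply: skew_psi_part; [exact: tau_lmap | exact: skew_lbr].
Qed.

Lemma represents_nu1 : represents (nu1_hat E) nu1.
Proof.
split; [exact: nu1_hatE | exact/biadditive_nu1_part/biadditive_lbr |].
by apply: skew_nu1_part; [exact: tau_lmap | exact: tau_lmap | exact: skew_lbr].
Qed.

Lemma represents_nu2 : represents (nu2_hat E) nu2.
Proof.
split; [exact: nu2_hatE | exact/biadditive_nu2_part/biadditive_lbr |].
by apply: skew_nu2_part; [exact: tau_lmap | exact: tau_lmap | exact: skew_lbr].
Qed.

Notation half := (scal 1 (2^-1 : K)).
Notation sixth := (scal 1 (6^-1 : K)).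

(** Every nested bracket in the twisted operations is a composite of derivations
    applied to one piece of the λ-bracket; the innermost argument acts first. *)
Lemma twisted_maurer_cartanP (B B' : {linear b -> a}) :
  let D := deriv B in let D' := deriv B' in
  twisted_maurer_cartan E (hom_cochain B) (hom_cochain B') <->
  D' nu2 + D' (D nu1) + half *: D' (D (D psi))
    + half *: (D' (D' nu1) + D' (D' (D psi))) + sixth *: D' (D' (D' psi)) = 0.
Proof.
move=> D D'.
have b1 C := represents_deriv C represents_nu1.
have bp C := represents_deriv C represents_psi.
have [E2 _ _] := represents_deriv B' represents_nu2.
have [E11 _ _] := represents_deriv B' (b1 B).
have [E12 _ _] := represents_deriv B' (b1 B').
have [E3 _ _] := represents_deriv B' (represents_deriv B (bp B)).
have [E4 _ _] := represents_deriv B' (represents_deriv B' (bp B)).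
have [E5 _ _] := represents_deriv B' (represents_deriv B' (bp B')).
set T := (X in _ <-> X = 0).
pose f := hom_cochain B; pose f' := hom_cochain B'.
have TE (x : 'I_2 -> ab) :
    l1_tw E f f' x + half *: (l2_tw E f f' f' : precochain 1 ab ab) x
      + sixth *: (l3_tw E f' f' f' : precochain 1 ab ab) x = T (x 0) (x 1).
  apply: congr2; first apply: congr2.
  - rewrite /l1_tw; apply: congr2; first apply: congr2.
    + exact: E2.
    + exact: E11.
    + exact: (congr1 (fun P => half *: P) (E3 x)).
  - apply: (congr1 (fun P => half *: P)).
    exact: (congr2 +%R (E12 x) (E4 x)).
  - apply: (congr1 (fun P => sixth *: P)).
    exact: E5.
split=> [MC|T0 x]; last by rewrite TE T0.
apply/funext => z; apply/funext => t.
pose x (i : 'I_2) := if i == 0 then z else t.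
exact: etrans (esym (TE x)) (MC x).
Qed.

(** * Left deformation maps are the zeros of the curvature *)

(** The elements Ĉ z + pb z are those of the graph, and the map pa - Ĉ vanishes
    exactly on the graph. *)
Lemma left_deformationP (C : {linear b -> a}) :
  let br z t := e (hat_map C z + pb z) (hat_map C t + pb t) in
  left_deformation E C <->
  (forall z t, p (br z t) - lmap (hat_map C) (br z t) = 0).
Proof.
move=> br; have graphE z : hat_map C z + pb z = (C z.2, z.2).
  by apply: injective_projections; rewrite /= ?addr0 ?add0r.
split=> [[_ _ cl] z t|flat].
  rewrite /br !graphE; apply/eqP; rewrite subr_eq0; apply/eqP/malgP => m.
  apply: etrans (mcoeff_lmap _ _ _) (etrans _ (esym (mcoeff_lmap _ _ _))).
  exact: (congr1 (ina b) (cl (C z.2, z.2) (C t.2, t.2) erefl erefl m)).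
split=> [|r x y /= -> ->|x y /= xC yC m]; first by rewrite /= raddf0.
  by rewrite linearP.
have := flat x y; rewrite /br !graphE -xC -yC -!surjective_pairing.
move=> /eqP; rewrite subr_eq0 => /eqP/malgP/(_ m).
move/(etrans (esym (mcoeff_lmap _ _ _))) => eq_m.
by have := etrans eq_m (mcoeff_lmap _ _ _); case.
Qed.

Lemma left_deformation_curvature (C : {linear b -> a}) :
  half *+ 2 = 1 -> sixth *+ 6 = 1 ->
  left_deformation E C <->
  curvature half sixth psi nu1 nu2 (hat_map C) (lmap (hat_map C)) = 0.
Proof.
move=> halfE sixthE.
pose br z t := e (hat_map C z + pb z) (hat_map C t + pb t).
have cE z t :
    curvature half sixth psi nu1 nu2 (hat_map C) (lmap (hat_map C)) z t =
      p (br z t) - lmap (hat_map C) (br z t).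
  have C0 y : hat_map C (ina b y) = 0.
    exact: etrans (congr1 (ina b) (raddf0 C)) (raddf0 _).
  apply: (@curvatureE _ _ _ half sixth e pa pb (hat_map C) p q
    (lmap (hat_map C)) (biadditive_lbr E) halfE sixthE).
  - by [].
  - by [].
  - by move=> y; apply: C0.
  - by move=> v; apply: lmap_comp0 => y; apply: C0.
  - by move=> v; apply: lmap_comp0 => y; apply: C0.
  - by move=> v; apply: lmap_comp.
  move=> x y; apply/malgP => m.
  apply: etrans (mcoeff_lmap pa _ m) _.
  apply: etrans _ (esym (@mcoeff0 _ _ m)).
  have [_ _ sub] := qt_sub E.
  have ab0 := sub (pb x) (pb y) erefl erefl m.
  exact: etrans (congr1 (ina b) ab0) (raddf0 _).
apply: iff_trans (left_deformationP C) _; split=> [flat|c0 z t].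
  by apply/funext => z; apply/funext => t; rewrite cE flat.
by rewrite -cE c0.
Qed.

(** The base field only enters through the scalars 1/2 and 1/6 of the
    Maurer-Cartan expression. *)
Lemma left_deformation_add (B B' : {linear b -> a}) :
  half *+ 2 = 1 -> sixth *+ 6 = 1 -> left_deformation E B ->
  left_deformation E (B \+ B') <->
  twisted_maurer_cartan E (hom_cochain B) (hom_cochain B').
Proof.
move=> halfE sixthE /(left_deformation_curvature B halfE sixthE) B0.
apply: iff_trans (left_deformation_curvature _ halfE sixthE) _.
apply: iff_trans _ (iff_sym (twisted_maurer_cartanP B B')).
have hatD z : hat_map (B \+ B') z = hat_map B z + hat_map B' z.
  exact: (raddfD (@ina K a b)).
have hat0 (C C' : {linear b -> a}) z : hat_map C (hat_map C' z) = 0.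
  exact: etrans (congr1 (ina b) (raddf0 C)) (raddf0 _).
have eB := biadditive_lbr E.
set S := (B \+ B' : {linear b -> a}).
have expand := @curvatureD _ _ _ half sixth psi nu1 nu2 halfE sixthE
  (biadditive_psi_part pa q eB) (biadditive_nu1_part pa pb p q eB)
  (biadditive_nu2_part pa pb p q eB) (hat_map B) (hat_map B') (hat_map S)
  (lmap (hat_map B)) (lmap (hat_map B')) (lmap (hat_map S)).
rewrite expand ?B0 ?add0r.
- by [].
- exact: hatD.
- by move=> v; apply: lmap_addmap.
- by move=> z; exact: etrans (hat0 B B' z) (esym (hat0 B' B z)).
move=> v; apply: etrans (lmap_comp0 v (hat0 B B')) (esym _).
exact: (lmap_comp0 v (hat0 B' B)).
Qed.

End QuasiTwilled.

Theorem theorem4p23 (R : realType) (a b : lmodType {poly R[i]})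
    (ha : finitely_generated a) (hb : finitely_generated b)
    (E : quasi_twilled a b) (B B' : {linear b -> a})
    (hB : left_deformation E B) :
  left_deformation E (B \+ B') <->
  twisted_maurer_cartan E (hom_cochain B) (hom_cochain B').
Proof.
have scalMn n : scal 1 (n.+1%:R^-1 : R[i]) *+ n.+1 = 1.
  rewrite /scal -monalgUMn -polyCMn -[_ *+ _]mulr_natr mulVf.
    by rewrite polyC1 mpolyC1E.
  by rewrite Num.Theory.pnatr_eq0.
exact: left_deformation_add (scalMn 1) (scalMn 5) hB.
Qed.
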